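(* For every nonzero $m\times n$ complex matrix $A=(a_{ij})$ and all integers $r\ge 0$ and $p\ge 1$, $$\sigma^{2p}(A)\le \max_{k\in[m],\ w_{|A|}^{r}(k)\neq 0}\frac{w_{|A|}^{r+p}(k)}{w_{|A|}^{r}(k)},$$ where $|A|=(|a_{ij}|)$ is the matrix of entrywise absolute values of $A$.
   Context: For a positive integer $N$, $[N]=\{1,\dots,N\}$. $\sigma(A)$ denotes the largest singular value of $A$, and $\sigma^{2p}(A)=(\sigma(A))^{2p}$. For an $m\times n$ complex matrix $M$ with conjugate transpose $M^{*}$, an integer $r\ge 0$ and $i,j\in[m]$, $w_M^r(i,j)$ denotes the $(i,j)$ entry of $(MM^{*})^r$ (with $(MM^* )^0=I_m$), and for $k\in[m]$, $w_M^r(k)=\sum_{i\in[m]}w_M^r(k,i)$ is the $k$th row sum of $(MM^{*})^r$. In the claim this is applied to $M=|A|$. *)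

(* Defs.v *)
From mathcomp Require Import all_boot all_order all_algebra.
From mathcomp Require Import sesquilinear spectral.
From mathcomp Require Import complex reals.

Set Implicit Arguments.
Unset Strict Implicit.
Unset Printing Implicit Defensive.

Import Order.TTheory GRing.Theory Num.Theory.

Local Open Scope ring_scope.
Local Open Scope sesquilinear_scope.

(* The order of a numClosedFieldType is partial, so that Num.max is only
   meaningful on comparable arguments.  All the maxima below range over
   nonnegative families, for which the default value 0 is harmless. *)
Lemma bigmax_ge0P (C : numDomainType) (I : finType) (P : pred I) (F : I -> C)
    (P_ex : exists i, P i) (F_ge0 : forall i, P i -> 0 <= F i) :
  (exists2 i, P i & \big[Num.max/0]_(i | P i) F i = F i) /\
  (forall i, P i -> F i <= \big[Num.max/0]_(i | P i) F i).
Proof.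
pose M := \big[Num.max/0]_(i | P i) F i.
have key (s : seq I) : let N := \big[Num.max/0]_(i <- s | P i) F i in
  [/\ 0 <= N, N = 0 \/ (exists2 i, P i & N = F i) &
      forall i, i \in s -> P i -> F i <= N].
  elim: s => [|x s [N0 NE Nub]] /=; first by rewrite big_nil; split=> //; left.
  rewrite big_cons; case: ifPn => [Px|/negPf nPx]; last first.
    split=> // i; rewrite inE => /orP[/eqP->|]; first by rewrite nPx.
    exact: Nub.
  have Fx0 := F_ge0 x Px.
  have cmp : F x >=< \big[Num.max/0]_(i <- s | P i) F i.
    by apply: real_comparable; exact: ger0_real.
  case: (comparable_leP cmp) => [le|/ltW le].
    split=> // i; rewrite inE => /orP[/eqP->//|]; exact: Nub.
  split=> //; first by right; exists x.
  move=> i; rewrite inE => /orP[/eqP->//|si Pi].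
  exact: le_trans (Nub i si Pi) le.
have [N0 NE Nub] := key (index_enum I).
have ub i : P i -> F i <= M by apply: Nub; exact: mem_index_enum.
split=> //; case: NE => [E|//].
have [i Pi] := P_ex; exists i => //.
by apply/eqP; rewrite eq_le ub // andbT /M E F_ge0.
Qed.

Section Defs.
Variable C : numClosedFieldType.

Section Matrix.
Variables m n : nat.
Implicit Type M : 'M[C]_(m, n).

Definition walk M (r : nat) (i j : 'I_m) : C := ((M *m M ^t*) ^+ r) i j.

Definition walk_row M (r : nat) (k : 'I_m) : C := \sum_(i < m) walk M r k i.

Definition absmx M : 'M[C]_(m, n) := map_mx Num.norm M.

(* The singular values are the nonnegative square roots of the eigenvalues of
   M^* M; those in excess of min(m, n) vanish and do not affect the maximum. *)
Definition singular_value M : pred C :=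
  [pred s | (0 <= s) && eigenvalue (M ^t* *m M) (s ^+ 2)].

Definition sigma M : C :=
  \big[Num.max/0]_(j < n) sqrtC (spectral_diag (M ^t* *m M) 0 j).

Lemma walk_row_absmx_ge0 M r k : 0 <= walk_row (absmx M) r k.
Proof.
apply: sumr_ge0 => i _; rewrite /walk; elim: r k i => [|r IHr] k i.
  by rewrite expr0 -idmxE mxE; case: (k == i); rewrite ?ler01 ?lexx.
rewrite exprS mxE; apply: sumr_ge0 => j _; apply: mulr_ge0 => //.
by rewrite mxE; apply: sumr_ge0 => l _; rewrite !mxE mulr_ge0 // conjC_ge0.
Qed.

Lemma walk_row_absmx_neq0 M r : M != 0 -> exists k, walk_row (absmx M) r k != 0.
Proof.
move=> M0; set N := absmx M *m (absmx M) ^t*.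
have N_ge0 i j : 0 <= N i j.
  by rewrite mxE; apply: sumr_ge0 => l _; rewrite !mxE mulr_ge0 // conjC_ge0.
have Nr_ge0 s i j : 0 <= (N ^+ s) i j.
  elim: s i j => [|s IHs] i j.
    by rewrite expr0 -idmxE mxE; case: (i == j); rewrite ?ler01 ?lexx.
  by rewrite exprS mxE; apply: sumr_ge0 => l _; rewrite mulr_ge0.
have [k Nk] : exists k, 0 < N k k.
  have /existsP[k /existsP[l Mkl]] : [exists k, exists l, M k l != 0].
    apply: contraNT M0 => /existsPn M0; apply/eqP/matrixP => k l.
    by have /existsPn/(_ l)/negPn/eqP -> := M0 k; rewrite mxE.
  exists k; rewrite mxE (bigD1 l) //= ltr_wpDr //.
    by apply: sumr_ge0 => h _; rewrite !mxE mul_conjC_ge0.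
  by rewrite !mxE mul_conjC_gt0 normr_eq0.
have Nrk s : 0 < (N ^+ s) k k.
  elim: s => [|s IHs]; first by rewrite expr0 -idmxE mxE eqxx ltr01.
  rewrite exprS mxE (bigD1 k) //= ltr_wpDr ?mulr_gt0 //.
  by apply: sumr_ge0 => l _; rewrite mulr_ge0.
exists k; rewrite gt_eqF // /walk_row (bigD1 k) //= ltr_wpDr ?Nrk //.
by apply: sumr_ge0 => i _; exact: Nr_ge0.
Qed.

Lemma eigenvalue_spectral_diag q (B : 'M[C]_q) a : B \is normalmx ->
  reflect (exists j, spectral_diag B 0 j = a) (eigenvalue B a).
Proof.
move=> /orthomx_spectralP; set P := spectralmx B; set D := spectral_diag B.
have Pu : P \in unitmx by exact: spectral_unit.
move=> BE; apply: (iffP eigenvalueP) => [[v vB v0]|[j <-]].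
  pose u := v *m invmx P.
  have u0 : u != 0.
    by apply: contraNneq v0 => u0; rewrite -[v](mulmxKV Pu) -/u u0 mul0mx.
  have uD : u *m diag_mx D = a *: u.
    rewrite /u scalemxAl -vB [in RHS]BE.
    by rewrite !mulmxA mulmxK.
  have /existsP[j uj] : [exists j, u 0 j != 0].
    apply: contraNT u0 => /existsPn u0; apply/eqP/rowP => j.
    by have /negPn/eqP -> := u0 j; rewrite mxE.
  exists j; apply: (mulfI uj); have /rowP/(_ j) := uD.
  by rewrite mul_mx_diag !mxE mulrC [RHS]mulrC => <-; rewrite mulrC.
exists (row j P); last first.
  by rewrite rowE mulmx_free_eq0 ?row_free_unit //; apply/eqP => /rowP/(_ j);
    rewrite !mxE !eqxx => /eqP; rewrite oner_eq0.
rewrite [in LHS]BE rowE !mulmxA mulmxK // -[_ *m diag_mx _]rowE.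
by rewrite row_diag_mx scalemxAl.
Qed.

Lemma gram_normal M : M ^t* *m M \is normalmx.
Proof.
by apply/normalmxP; rewrite trmx_mul map_mxM /= trmxCK.
Qed.

Lemma gram_eigenvalue_ge0 M a : eigenvalue (M ^t* *m M) a -> 0 <= a.
Proof.
have norm_ge0 q (v : 'rV[C]_q) : 0 <= (v *m v ^t*) 0 0.
  by rewrite mxE; apply: sumr_ge0 => j _; rewrite !mxE mul_conjC_ge0.
move=> /eigenvalueP[v vB v0].
have v_gt0 : 0 < (v *m v ^t*) 0 0.
  have /existsP[j vj] : [exists j, v 0 j != 0].
    apply: contraNT v0 => /existsPn v0; apply/eqP/rowP => j.
    by have /negPn/eqP -> := v0 j; rewrite mxE.
  rewrite mxE (bigD1 j) //= ltr_wpDr //.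
    by apply: sumr_ge0 => i _; rewrite !mxE mul_conjC_ge0.
  by rewrite !mxE mul_conjC_gt0.
rewrite -(pmulr_lge0 _ v_gt0).
have -> : a * (v *m v ^t*) 0 0 = ((v *m M ^t*) *m (v *m M ^t*) ^t*) 0 0.
  rewrite trmx_mul map_mxM /= trmxCK !mulmxA -(mulmxA v) vB -scalemxAl.
  by rewrite [RHS]mxE.
exact: norm_ge0.
Qed.

Lemma sigmaP M : (0 < n)%N ->
  singular_value M (sigma M) /\
  (forall s, singular_value M s -> s <= sigma M).
Proof.
move=> n_gt0; pose d := spectral_diag (M ^t* *m M).
have ev j : eigenvalue (M ^t* *m M) (d 0 j).
  by apply/(eigenvalue_spectral_diag _ (gram_normal M)); exists j.
have d_ge0 j : 0 <= d 0 j by exact: gram_eigenvalue_ge0 (ev j).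
have [|j _|[j _ E] ub] := @bigmax_ge0P C 'I_n xpredT (fun j => sqrtC (d 0 j)).
- by exists (Ordinal n_gt0).
- by rewrite sqrtC_ge0.
rewrite /sigma -/d; split.
  by rewrite E; apply/andP; rewrite /= sqrtC_ge0 d_ge0 sqrtCK ev.
move=> s /andP[s_ge0 /(eigenvalue_spectral_diag _ (gram_normal M))[i di]].
by apply: le_trans (ub i isT); rewrite /= /d di sqrCK.
Qed.

End Matrix.
End Defs.

(* Main.v *)
(** Put [B = |A| |A|^*] and let [v] be the vector of row sums of [B^r].  A left
    eigenvector [x] of [A^* A] for [sigma^2 <> 0] gives the left eigenvector
    [y = x A^*] of [A A^*], and the triangle inequality yields
    [sigma^(2p) |y| <= |y| B^p] entrywise.  If [rho] is the maximum on the right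
    of the theorem, then [B^p v <= rho v] entrywise: where [v] vanishes the row
    of [A] vanishes, hence so does that of [B^p].  Pairing [|y|] with [v] gives
    [sigma^(2p) (|y| . v) <= rho (|y| . v)], and [|y| . v > 0] because [y] is
    supported on the nonzero rows of [A]. *)
Require Import Defs.
From mathcomp Require Import all_boot all_order all_algebra.
From mathcomp Require Import sesquilinear.
From mathcomp Require Import complex reals.

Import Order.TTheory GRing.Theory Num.Theory.

Local Open Scope ring_scope.

Section AbsoluteWalks.
Local Open Scope sesquilinear_scope.
Variables (C : numClosedFieldType) (m n : nat).
Implicit Types (M A : 'M[C]_(m, n)) (r p : nat) (i j k : 'I_m).

Lemma walkS M r i j :
  walk M r.+1 i j = \sum_k (M *m M ^t*) i k * walk M r k j.
Proof. by rewrite /walk exprS mxE. Qed.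

Lemma walk_rowD M r p k :
  walk_row M (r + p) k = \sum_j walk M p k j * walk_row M r j.
Proof.
rewrite /walk_row /walk addnC exprD.
under eq_bigr do rewrite mxE.
by rewrite exchange_big; apply: eq_bigr => j _; rewrite -mulr_sumr.
Qed.

Lemma gram_absmx_ge0 A i j : 0 <= (absmx A *m (absmx A) ^t*) i j.
Proof.
by rewrite mxE sumr_ge0 // => l _; rewrite !mxE mulr_ge0 // conjC_ge0.
Qed.

Lemma walk_absmx_ge0 A r i j : 0 <= walk (absmx A) r i j.
Proof.
elim: r i j => [|r IHr] i j.
  by rewrite /walk expr0 -idmxE mxE ler0n.
by rewrite walkS sumr_ge0 // => k _; rewrite mulr_ge0 ?gram_absmx_ge0.
Qed.

(** The triangle inequality is applied twice at each induction step: to the sum over the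
    intermediate vertex, and inside the entry of [A *m A ^t*]. *)
Lemma norm_walk_le A r i j : `|walk A r i j| <= walk (absmx A) r i j.
Proof.
elim: r i j => [|r IHr] i j.
  by rewrite /walk expr0 -idmxE !mxE normr_nat.
rewrite !walkS; apply: le_trans (ler_norm_sum _ _ _) _.
apply: ler_sum => k _; rewrite normrM ler_pM //.
rewrite !mxE; apply: le_trans (ler_norm_sum _ _ _) _.
apply: ler_sum => l _.
by rewrite !mxE normrM norm_conjC conj_normC.
Qed.

(** The closed walk going [r] times from row [k] to column [l] and back contributes
    [|A k l| ^ (2 r)], and no other walk is negative. *)
Lemma walk_absmx_diag_gt0 A r k l : A k l != 0 -> 0 < walk (absmx A) r k k.
Proof.
move=> Akl; elim: r => [|r IHr].
  by rewrite /walk expr0 -idmxE mxE eqxx ltr01.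
rewrite walkS (bigD1 k) //= ltr_wpDr ?sumr_ge0 //.
  by move=> j _; rewrite mulr_ge0 ?gram_absmx_ge0 ?walk_absmx_ge0.
rewrite mulr_gt0 // mxE (bigD1 l) //= ltr_wpDr ?sumr_ge0 //.
  by move=> h _; rewrite !mxE mul_conjC_ge0.
by rewrite !mxE mul_conjC_gt0 normr_eq0.
Qed.

Lemma walk_row_absmx_gt0 A r k l : A k l != 0 -> 0 < walk_row (absmx A) r k.
Proof.
move=> /(walk_absmx_diag_gt0 A r) Akl.
rewrite /walk_row (bigD1 k) //= ltr_wpDr ?sumr_ge0 // => j _.
exact: walk_absmx_ge0.
Qed.

Lemma walk_row_absmx_eq0 A r p k : (0 < p)%N ->
  walk_row (absmx A) r k = 0 -> walk_row (absmx A) (r + p) k = 0.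
Proof.
case: p => // p _ w0.
have Ak0 l : A k l = 0.
  by apply: contra_eq w0 => /(walk_row_absmx_gt0 A r) /gt_eqF ->.
rewrite walk_rowD big1 // => j _; rewrite walkS big1 ?mul0r // => h _.
by rewrite mxE big1 ?mul0r // => l _; rewrite !mxE Ak0 normr0 mul0r.
Qed.

Lemma left_eigenvector_walk M r (y : 'rV[C]_m) a :
  y *m (M *m M ^t*) = a *: y ->
  forall j, a ^+ r * y 0 j = \sum_i y 0 i * walk M r i j.
Proof.
move=> yM j.
have -> : \sum_i y 0 i * walk M r i j = (y *m (M *m M ^t*) ^+ r) 0 j.
  by rewrite mxE.
suff -> : y *m (M *m M ^t*) ^+ r = a ^+ r *: y by rewrite mxE.
elim: r => [|r IHr]; first by rewrite !expr0 -idmxE mulmx1 scale1r.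
by rewrite exprS -mulmxE mulmxA yM -scalemxAl IHr scalerA -exprS.
Qed.

Lemma gram_eigenvalue_le A r p a (rho : C) : a != 0 ->
  eigenvalue (A ^t* *m A) a ->
  (forall k, walk_row (absmx A) (r + p) k <= rho * walk_row (absmx A) r k) ->
  `|a| ^+ p <= rho.
Proof.
move=> a0 /eigenvalueP[x xA x0] rhoP.
pose y := x *m A ^t*; set v := walk_row (absmx A) r in rhoP.
(* Since [y *m A = a *: x] with [a != 0], a zero [y] would force [x = 0]. *)
have y0 : y != 0.
  apply: contraNneq x0 => y0; move/eqP: xA.
  by rewrite mulmxA -/y y0 mul0mx eq_sym scaler_eq0 (negPf a0).
have yA : y *m (A *m A ^t*) = a *: y.
  by rewrite /y !mulmxA -(mulmxA x) xA scalemxAl.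
have v_ge0 k : 0 <= v k by exact: walk_row_absmx_ge0.
have yv_gt0 : 0 < \sum_j `|y 0 j| * v j.
  have /rV0Pn[j yj] := y0.
  rewrite (bigD1 j) //= ltr_wpDr ?sumr_ge0 //; first by move=> k _; rewrite mulr_ge0.
  have /existsP[l Ajl] : [exists l, A j l != 0].
    apply: contraNT yj => /existsPn Aj; rewrite mxE big1 // => l _.
    by have /negPn/eqP Ajl := Aj l; rewrite !mxE Ajl conjC0 mulr0.
  by rewrite mulr_gt0 ?normr_gt0 //; exact: walk_row_absmx_gt0 Ajl.
rewrite -(ler_pM2r yv_gt0) !mulr_sumr.
apply: (@le_trans _ _ (\sum_j (\sum_i `|y 0 i| * walk (absmx A) p i j) * v j)).
  apply: ler_sum => j _; rewrite mulrA ler_wpM2r // -normrX -normrM.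
  rewrite (left_eigenvector_walk A p y a yA).
  apply: le_trans (ler_norm_sum _ _ _) _; apply: ler_sum => i _.
  by rewrite normrM ler_wpM2l ?norm_walk_le.
(* Swapping the sums moves the [p] steps from [|y|] onto [v], which yields the row sums at
   [r + p]. *)
under eq_bigr do rewrite mulr_suml.
rewrite exchange_big; apply: ler_sum => i _ /=.
rewrite mulrCA; under eq_bigr do rewrite -mulrA.
by rewrite -mulr_sumr -walk_rowD ler_wpM2l.
Qed.

End AbsoluteWalks.

Theorem theorem1 (R : realType) (m n : nat) (A : 'M[R[i]]_(m, n)) (r p : nat)
    (hA : A != 0) (hp : (1 <= p)%N) :
  sigma A ^+ (2 * p) <=
  \big[Num.max/0]_(k < m | walk_row (absmx A) r k != 0)
    (walk_row (absmx A) (r + p) k / walk_row (absmx A) r k).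
Proof.
set rho := \big[_/_]_(k < m | _) _.
have F_ge0 k : walk_row (absmx A) r k != 0 ->
    0 <= walk_row (absmx A) (r + p) k / walk_row (absmx A) r k.
  by rewrite divr_ge0 ?walk_row_absmx_ge0.
have [[k0 k0P rhoE] rho_ub] := bigmax_ge0P (walk_row_absmx_neq0 r hA) F_ge0.
(* With a column present, [sigma A] is a genuine singular value and not the default [0] of an empty
   maximum. *)
have n_gt0 : (0 < n)%N.
  by case: n A hA {rho F_ge0 k0P rhoE rho_ub} => // B; rewrite thinmx0 eqxx.
have [/andP[s_ge0 s_ev] _] := sigmaP A n_gt0.
rewrite exprM; have [-> | s_neq0] := eqVneq (sigma A ^+ 2) 0.
  by rewrite expr0n gtn_eqF //= /rho rhoE F_ge0.
rewrite -[sigma A ^+ 2]ger0_norm ?exprn_ge0 //.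
apply: (gram_eigenvalue_le _ _ _ A r p _ _ s_neq0 s_ev) => k.
(* Rows of zero weight lie outside the range of the maximum; there both sides vanish, as
   [p >= 1]. *)
have [w0|w_neq0] := eqVneq (walk_row (absmx A) r k) 0.
  by rewrite w0 mulr0 walk_row_absmx_eq0.
rewrite -ler_pdivrMr; first exact: rho_ub.
by rewrite lt_def w_neq0 walk_row_absmx_ge0.
Qed.
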